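(* Let $\mathbf{w}\in\mathcal{K}_{m+}\subset\mathbb{R}^n$. For every $\mathbf{v}\in\mathbb{R}^n$, $$\mathrm{prox}_{\Omega_{\mathbf{w}}}(\mathbf{v})=\mathrm{sign}(\mathbf{v})\odot\Bigl(\mathbf{P}(|\mathbf{v}|)^T\,\mathrm{proj}_{\mathbb{R}_+^n}\bigl(\mathrm{proj}_{\mathcal{K}_m}(|\mathbf{v}|_{\downarrow}-\mathbf{w})\bigr)\Bigr).$$
   Context: $\mathcal{K}_{m+}=\{\mathbf{x}\in\mathbb{R}^n: x_1\ge x_2\ge\cdots\ge x_n\ge 0\}$ is the monotone non-negative cone and $\mathcal{K}_m=\{\mathbf{x}\in\mathbb{R}^n:x_1\ge x_2\ge\cdots\ge x_n\}$ is the monotone cone. For $\mathbf{x}\in\mathbb{R}^n$, $|\mathbf{x}|$ is the vector of absolute values of its components, $|\mathbf{x}|_{\downarrow}$ is that vector sorted in non-increasing order, and $\mathbf{P}(|\mathbf{x}|)$ is a permutation matrix (ties broken arbitrarily) such that $|\mathbf{x}|_{\downarrow}=\mathbf{P}(|\mathbf{x}|)\,|\mathbf{x}|$. The ordered weighted $\ell_1$ (OWL) norm is $\Omega_{\mathbf{w}}(\mathbf{x})=\mathbf{w}^T|\mathbf{x}|_{\downarrow}$, and its proximity operator is $\mathrm{prox}_{\Omega_{\mathbf{w}}}(\mathbf{v})=\arg\min_{\mathbf{x}\in\mathbb{R}^n}\tfrac12\|\mathbf{x}-\mathbf{v}\|_2^2+\Omega_{\mathbf{w}}(\mathbf{x})$.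 $\mathrm{proj}_C$ denotes the Euclidean projection onto a closed convex set $C$ (for $C=\mathbb{R}^n_+$, component-wise clipping at zero); $\mathrm{sign}$ is applied component-wise and $\odot$ is the entry-wise product. *)

(* Defs.v *)
From mathcomp Require Import all_boot all_order all_algebra.
From mathcomp Require Import classical_sets reals.

Set Implicit Arguments.
Unset Strict Implicit.
Unset Printing Implicit Defensive.

Import Order.TTheory GRing.Theory Num.Theory.
Local Open Scope classical_set_scope.
Local Open Scope ring_scope.

Section OWL.
Context {R : realType} {n : nat}.
Implicit Types (x y u v w : 'cV[R]_n) (C : set 'cV[R]_n) (P : 'M[R]_n).

Definition monotone_cone : set 'cV[R]_n :=
  [set x | forall i j : 'I_n, (i <= j)%N -> x j 0 <= x i 0].

Definition nonneg_orthant : set 'cV[R]_n := [set x | forall i, 0 <= x i 0].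

Definition monotone_nonneg_cone : set 'cV[R]_n :=
  monotone_cone `&` nonneg_orthant.

(* The norm on matrices provided by the library is the sup norm. *)
Definition l2norm x : R := Num.sqrt (\sum_i x i 0 ^+ 2).

Definition hadamard x y : 'cV[R]_n := map2_mx *%R x y.

Definition vsign x : 'cV[R]_n := map_mx Num.sg x.

Definition vabs x : 'cV[R]_n := map_mx Num.norm x.

Definition sort_down x : 'cV[R]_n :=
  \col_i (sort >=%R [seq x j 0 | j <- enum 'I_n])`_i.

(* Several P satisfy this when x has ties. *)
Definition sorting_perm_mx P x : Prop :=
  is_perm_mx P /\ sort_down x = P *m x.

Definition argmin C (f : 'cV[R]_n -> R) : set 'cV[R]_n :=
  [set x | C x /\ forall y, C y -> f x <= f y].

(* The default value 0 is never used when C is nonempty, closed and convex: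
   the minimizer then exists and is unique. *)
Definition proj C u : 'cV[R]_n := xget 0 (argmin C (fun x => l2norm (x - u))).

Definition owl w x : R := (w^T *m sort_down (vabs x)) 0 0.

(* Set-valued, so that prox f v = [set p] states that p is a minimizer and
   that it is the only one. *)
Definition prox (f : 'cV[R]_n -> R) v : set 'cV[R]_n :=
  argmin setT (fun x => 2^-1 * l2norm (x - v) ^+ 2 + f x).

End OWL.

(* Main.v *)
Require Import Defs.
From mathcomp Require Import all_boot all_order all_algebra fingroup perm.
From mathcomp Require Import ring lra.
From mathcomp Require Import classical_sets reals topology normedtype derive.
Local Open Scope classical_set_scope.
Local Open Scope ring_scope.

Import Order.TTheory GRing.Theory Num.Theory numFieldNormedType.Exports.

(* Put a = |v| sorted and t = proj_{R_+}(proj_{K_m}(a - w)). By the rearrangement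
   inequality the objective at x is at least |b - a|^2/2 + <w, b> with b = |x|
   sorted, and it equals this bound when x is the claimed point p, for which
   b = t. Up to a constant the bound is |b - (a - w)|^2/2, which t minimizes over
   K_{m+}: the residual a - w - t is polar to K_{m+} and orthogonal to t. Since
   sign(0) = 0, the identity |p| = P^T t needs t to vanish wherever a does.
   Uniqueness follows from strict convexity, the midpoint convexity of the OWL
   norm being again the rearrangement inequality. *)

(** * Inner product and Euclidean norm *)

Section Dot.
Context {R : realType} {n : nat}.
Implicit Types (x y z : 'cV[R]_n) (c : R) (s : 'S_n).

Definition dot x y : R := \sum_i x i 0 * y i 0.

Lemma dotC x y : dot x y = dot y x.
Proof. by apply: eq_bigr => i _; rewrite mulrC. Qed.

Lemma dotDl x y z : dot (x + y) z = dot x z + dot y z.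
Proof. by rewrite -big_split; apply: eq_bigr => i _; rewrite mxE mulrDl. Qed.

Lemma dotZl c x z : dot (c *: x) z = c * dot x z.
Proof. by rewrite mulr_sumr; apply: eq_bigr => i _; rewrite mxE mulrA. Qed.

Lemma dotNl x z : dot (- x) z = - dot x z.
Proof. by rewrite -scaleN1r dotZl mulN1r. Qed.

Lemma dotDr x y z : dot x (y + z) = dot x y + dot x z.
Proof. by rewrite ![dot x _]dotC dotDl. Qed.

Lemma dotZr c x z : dot x (c *: z) = c * dot x z.
Proof. by rewrite ![dot x _]dotC dotZl. Qed.

Lemma dotNr x z : dot x (- z) = - dot x z.
Proof. by rewrite ![dot x _]dotC dotNl. Qed.

Definition dotE := (dotDl, dotDr, dotNl, dotNr, dotZl, dotZr).

Lemma dot_ge0 x y :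
  nonneg_orthant x -> nonneg_orthant y -> 0 <= dot x y.
Proof. by move=> x0 y0; apply: sumr_ge0 => i _; exact: mulr_ge0. Qed.

Lemma dotxx_ge0 x : 0 <= dot x x.
Proof. by apply: sumr_ge0 => i _; rewrite -expr2 sqr_ge0. Qed.

Lemma dotxx_eq0 x : dot x x = 0 -> x = 0.
Proof.
move/eqP; rewrite psumr_eq0 => [/allP x0|i _]; last by rewrite -expr2 sqr_ge0.
apply/matrixP => i j; rewrite ord1 mxE; apply/eqP.
by have := x0 i (mem_index_enum i); rewrite /= mulf_eq0 orbb.
Qed.

Lemma dot_row_perm s x y : dot (row_perm s x) (row_perm s y) = dot x y.
Proof.
by rewrite [RHS](reindex_perm s); apply: eq_bigr => i _; rewrite !mxE.
Qed.

Lemma l2norm_sqr x : l2norm x ^+ 2 = dot x x.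
Proof.
rewrite /l2norm (eq_bigr (fun i => x i 0 * x i 0)); first exact: sqr_sqrtr (dotxx_ge0 x).
by move=> i _; rewrite expr2.
Qed.

Lemma l2norm_ge0 x : 0 <= l2norm x.
Proof. exact: sqrtr_ge0. Qed.

Lemma ler_l2norm x y : (l2norm x <= l2norm y) = (dot x x <= dot y y).
Proof. by rewrite -!l2norm_sqr ler_pXn2r ?nnegrE ?l2norm_ge0. Qed.

(** Confines Euclidean balls to boxes in the compactness argument for projections. *)
Lemma coord_le_l2norm x i : `|x i 0| <= l2norm x.
Proof.
rewrite -(ler_pXn2r (n := 2)) ?nnegrE ?l2norm_ge0 // l2norm_sqr real_normK ?num_real //.
rewrite /dot (bigD1 i) //= -expr2 lerDl.
by apply: sumr_ge0 => j _; rewrite -expr2 sqr_ge0.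
Qed.

End Dot.

(** * The rearrangement inequality for sequences *)

Section Rearrangement.
Context {R : realType}.
Implicit Types (f : nat -> R) (t : seq R).

Let ger_trans : transitive (>=%R : rel R).
Proof. by move=> y x z yx zy; exact: le_trans zy yx. Qed.

Let ger_total : total (>=%R : rel R).
Proof. by move=> x y; exact: le_total. Qed.

Let ger_anti : antisymmetric (>=%R : rel R).
Proof. by move=> x y /andP[xy yx]; apply: le_anti; apply/andP. Qed.

(** Antisymmetry of the order makes a sorted rearrangement unique. *)
Lemma sort_ge_eq t1 t2 : sorted >=%R t2 -> perm_eq t1 t2 -> sort >=%R t1 = t2.
Proof.
move=> t2s t12; apply: (sorted_eq ger_trans ger_anti) => //.
  exact: sort_sorted.
by rewrite perm_sort.
Qed.

(** Moving [y] past a larger neighbour [z] gains [(f i - f i.+1) * (z - y) >= 0]; the induction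
    shifts the weights [f] by one. *)
Lemma sum_mul_merge_ge f y t :
  (forall i j, (i <= j <= size t)%N -> f j <= f i) ->
  f 0%N * y + \sum_(i < size t) f i.+1 * t`_i
    <= \sum_(i < (size t).+1) f i * (merge >=%R [:: y] t)`_i.
Proof.
elim: t f => [|z t IH] f fmono /=.
  by rewrite big_ord_recl !big_ord0 /= lexx.
case: ifP => [_|]; first by rewrite [leRHS]big_ord_recl.
move=> /negbT; rewrite -ltNge => yz.
rewrite big_ord_recl [leRHS]big_ord_recl /=.
have := IH (fun i => f i.+1) (fun i j ij => fmono i.+1 j.+1 ij).
have : f 1%N <= f 0%N by apply: fmono.
rewrite /bump /=.
under [X in _ -> _ -> _ + (_ + X) <= _]eq_bigr do rewrite add1n.
under [X in _ -> _ -> _ <= _ + X]eq_bigr do rewrite add1n.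
move=> f10 H; nra.
Qed.

Lemma sum_mul_sort_ge f t :
  (forall i j, (i <= j < size t)%N -> f j <= f i) ->
  \sum_(i < size t) f i * t`_i <= \sum_(i < size t) f i * (sort >=%R t)`_i.
Proof.
elim: t f => [|y t IH] f fmono; first by rewrite !big_ord0.
rewrite [size _]/= big_ord_recl /=.
(* Insertion sort: both sides are sorted rearrangements of the same sequence. *)
have -> : sort >=%R (y :: t) = merge >=%R [:: y] (sort >=%R t).
  apply: sort_ge_eq; first by rewrite merge_sorted // sort_sorted.
  by rewrite perm_sym perm_merge /= perm_cons perm_sort.
have := @sum_mul_merge_ge f y (sort >=%R t); rewrite size_sort => /(_ fmono).
apply: le_trans; rewrite lerD2l.
exact: (IH (fun i => f i.+1) (fun i j => fmono i.+1 j.+1)).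
Qed.

End Rearrangement.

(** * Sorting the coordinates of a vector *)

Section SortDown.
Context {R : realType} {n : nat}.
Implicit Types (x y : 'cV[R]_n) (s : 'S_n).

Let size_col x : size [seq x j 0 | j <- enum 'I_n] = n.
Proof. by rewrite size_map size_enum_ord. Qed.

Let nth_col x (i : 'I_n) : [seq x j 0 | j <- enum 'I_n]`_i = x i 0.
Proof.
by rewrite (nth_map i) ?size_enum_ord ?ltn_ord // nth_ord_enum.
Qed.

Let perm_col s x :
  perm_eq [seq row_perm s x j 0 | j <- enum 'I_n] [seq x j 0 | j <- enum 'I_n].
Proof.
rewrite (eq_map (g := (fun i => x i 0) \o s)); last by move=> i /=; rewrite mxE.
rewrite map_comp; apply: perm_map; apply: uniq_perm.
- by rewrite map_inj_uniq ?enum_uniq //; exact: perm_inj.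
- exact: enum_uniq.
- move=> i; rewrite mem_enum; apply/mapP; exists ((s^-1)%g i); rewrite ?mem_enum //.
  by rewrite permKV.
Qed.

Lemma sort_down_row_perm s x : sort_down (row_perm s x) = sort_down x.
Proof.
apply/matrixP => i j; rewrite !mxE; congr (nth _ _ _).
apply: sort_ge_eq; last by rewrite perm_sym perm_sort perm_sym perm_col.
by apply: sort_sorted => ? ?; exact: le_total.
Qed.

Lemma sort_down_id x : monotone_cone x -> sort_down x = x.
Proof.
move=> xm; apply/matrixP => i j; rewrite ord1 mxE -[RHS]nth_col.
congr (nth _ _ _); apply: sort_ge_eq => //.
apply/(sortedP 0) => k; rewrite size_col => kn.
rewrite (nth_col x (Ordinal kn)) (nth_col x (Ordinal (ltnW kn))).
exact: xm.
Qed.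

(** Lets a sort be replaced by a coordinate permutation; [dot] is unchanged when both arguments are
    permuted alike. *)
Lemma sort_downP x : exists s, sort_down x = row_perm s x.
Proof.
have : perm_eq (sort >=%R [seq x j 0 | j <- enum 'I_n])
   [tuple x j 0 | j < n].
  by rewrite perm_sort.
case/tuple_permP => s E; exists s; apply/matrixP => i j.
rewrite ord1 !mxE E /= (nth_map i) ?size_enum_ord ?ltn_ord // nth_ord_enum.
by rewrite tnth_mktuple.
Qed.

Lemma sort_down_monotone x : monotone_cone (sort_down x).
Proof.
move=> i j ij; rewrite !mxE.
apply: (sorted_leq_nth (leT := >=%R)); rewrite ?inE ?size_sort ?size_col //.
- by move=> a b c ba cb; exact: le_trans cb ba.
- by move=> a; exact: lexx.
- by apply: sort_sorted => ? ?; exact: le_total.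
Qed.

(** The rearrangement inequality for vectors, with the coordinates of [x] as non-increasing
    weights. *)
Lemma dot_le_sort_down x y :
  monotone_cone x -> dot x y <= dot x (sort_down y).
Proof.
move=> xm.
have := @sum_mul_sort_ge R (nth 0 [seq x j 0 | j <- enum 'I_n])
  [seq y j 0 | j <- enum 'I_n].
rewrite size_col => H.
have E z : dot x z = \sum_(i < n) [seq x j 0 | j <- enum 'I_n]`_i * z i 0.
  by apply: eq_bigr => i _; rewrite nth_col.
rewrite !E; under eq_bigr do rewrite -nth_col.
under [leRHS]eq_bigr do rewrite mxE.
apply: H => i j /andP[ij jn].
rewrite (nth_col x (Ordinal jn)) (nth_col x (Ordinal (leq_ltn_trans ij jn))).
exact: xm.
Qed.

End SortDown.

(** * Projections onto the monotone cone and the orthant *)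

Section Projection.
Context {R : realType} {n : nat}.
Implicit Types (x y z u : 'cV[R]_n).

(** By compactness: points of [C] farther from [u] than [x0] can be discarded, and the others lie in
    a box of half-width [r], where the continuous squared distance attains its minimum on [C]. *)
Lemma argmin_l2norm_nonempty (C : set 'cV[R]_n) u :
  closed [set r : 'rV[R]_n | C r^T] -> C !=set0 ->
  argmin C (fun x => l2norm (x - u)) !=set0.
Proof.
move=> Cc [x0 Cx0]; set r := l2norm (x0 - u).
pose box := [set y : 'rV[R]_n |
  forall i, `[u i 0 - r, u i 0 + r]%classic (y ord0 i)].
have boxP y : (forall i, `|y i 0 - u i 0| <= r) -> box y^T.
  by move=> yu i; rewrite /= in_itv /= mxE -ler_distl.
have boxc : compact (box `&` [set y : 'rV[R]_n | C y^T]).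
  apply: compact_closedI Cc.
  apply: (rV_compact (A := fun i => `[u i 0 - r, u i 0 + r]%classic)) => i.
  exact: segment_compact.
have near_box y : l2norm (y - u) <= r -> box y^T.
  move=> yr; apply: boxP => i; apply: le_trans yr.
  by have := coord_le_l2norm (y - u) i; rewrite !mxE.
pose f (y : 'rV[R]_n) := \sum_i (y ord0 i - u i 0) * (y ord0 i - u i 0).
have fE y : f y^T = dot (y - u) (y - u).
  by apply: eq_bigr => i _; rewrite !mxE.
have fc : continuous f.
  apply: continuous_big => [|i _ y]; first exact: add_continuous.
  have gc : {for y, continuous (fun y : 'rV[R]_n => y ord0 i - u i 0)}.
    by apply: (@continuousB _ _ _ (fun y : 'rV[R]_n => y ord0 i));
      [exact: coord_continuous|exact: cst_continuous].
  exact: (continuousM gc gc).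
have [|c /set_mem [_ Cc'] cmin] := EVT_min_rV _ boxc (continuous_subspaceT fc).
  by exists x0^T; split; [exact: near_box|rewrite /= trmxK].
exists c^T; split => // y Cy; rewrite ler_l2norm -!fE trmxK.
have [yr|ry] := leP (l2norm (y - u)) r.
  by apply: cmin; apply/mem_set; split; [exact: near_box|rewrite /= trmxK].
apply: (@le_trans _ _ (f x0^T)).
  by apply: cmin; apply/mem_set; split; [exact: near_box|rewrite /= trmxK].
by rewrite !fE -ler_l2norm ltW.
Qed.

(** Nonemptiness rules out the default value of [xget]. *)
Lemma projP (C : set 'cV[R]_n) u :
  argmin C (fun x => l2norm (x - u)) !=set0 ->
  argmin C (fun x => l2norm (x - u)) (proj C u).
Proof. by move=> [x xC]; rewrite /proj; case: xgetP => [//|/(_ x)]. Qed.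

Lemma monotone_coneD x y :
  monotone_cone x -> monotone_cone y -> monotone_cone (x + y).
Proof. by move=> xm ym i j ij; rewrite !mxE lerD ?xm ?ym. Qed.

Lemma monotone_coneZ (c : R) x :
  0 <= c -> monotone_cone x -> monotone_cone (c *: x).
Proof. by move=> c0 xm i j ij; rewrite !mxE ler_wpM2l ?xm. Qed.

(** The cone is an intersection of closed half-spaces, one for each ordered pair of indices. *)
Lemma monotone_cone_closed :
  closed [set r : 'rV[R]_n | monotone_cone r^T].
Proof.
rewrite (_ : [set r | _] = \bigcap_(p in [set p : 'I_n * 'I_n | (p.1 <= p.2)%N])
   [set r : 'rV[R]_n | 0 <= r ord0 p.1 - r ord0 p.2]); last first.
  apply/seteqP; split => r /= rm.
    by move=> [i j] /= /rm; rewrite !mxE subr_ge0.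
  by move=> i j ij; have := rm (i, j) ij; rewrite /= !mxE subr_ge0.
apply: closed_bigI => -[i j] _ /=.
apply: (@preimage_closed _ _ (fun r : 'rV[R]_n => r ord0 i - r ord0 j) [set x | 0 <= x]).
  by move=> r _; apply: (@continuousB _ _ _ (fun r : 'rV[R]_n => r ord0 i)
    (fun r => r ord0 j)); exact: coord_continuous.
exact: closed_ge.
Qed.

(* Compare z := proj u with z + c y for small c > 0, and with z + c z for c of
   either sign. *)
Lemma proj_monotone_cone_polar u (z := proj monotone_cone u) :
  [/\ monotone_cone z,
      forall y, monotone_cone y -> dot (u - z) y <= 0 & dot (u - z) z = 0].
Proof.
have [zm zmin] : argmin monotone_cone (fun x => l2norm (x - u)) z.
  apply: projP; apply: argmin_l2norm_nonempty; first exact: monotone_cone_closed.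
  by exists 0 => i j _; rewrite !mxE.
(* Expansion of [|z - u|^2 <= |z + c y - u|^2]. *)
have step y (c : R) : monotone_cone (z + c *: y) ->
    2 * c * dot (u - z) y <= c ^+ 2 * dot y y.
  move/zmin; rewrite ler_l2norm.
  by rewrite !dotE (dotC y z) (dotC y u) (dotC u z); lra.
have small (a b : R) : (forall c, 0 < c <= 1 -> 2 * c * a <= c ^+ 2 * b) -> a <= 0.
  move=> ab; rewrite leNgt; apply/negP => a0.
  have b1 : 0 < 1 + `|b| by rewrite ltr_pwDl.
  (* This [c] lies in [(0, 1]] and [c (1 + |b|) = a (1 - c) < a], so [c b < 2 a], against the
     assumption. *)
  have := ab (a / (a + (1 + `|b|))).
  have ab0 : 0 < a + (1 + `|b|) by exact: addr_gt0.
  rewrite divr_gt0 // ler_pdivrMr // mul1r lerDl (ltW b1) => /(_ isT).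
  set c := _ / _; have c0 : 0 < c by exact: divr_gt0.
  have cE : c * (a + (1 + `|b|)) = a by rewrite divfK // gt_eqF.
  have := ler_norm b; nra.
split => //.
  move=> y ym; apply: (small _ (dot y y)) => c /andP[c0 _].
  by apply/step/monotone_coneD => //; apply: monotone_coneZ => //; exact: ltW.
apply/eqP; rewrite eq_le; apply/andP; split.
  apply: (small _ (dot z z)) => c /andP[c0 _].
  by apply/step/monotone_coneD => //; apply: monotone_coneZ => //; exact: ltW.
(* For [c <= 1] the point [z - c z = (1 - c) z] stays in the cone. *)
rewrite -oppr_le0; apply: (small _ (dot z z)) => c /andP[c0 c1].
have := step z (- c); rewrite sqrrN mulrN mulNr -mulrN; apply.
rewrite -[X in X + _]scale1r -scalerDl; apply: monotone_coneZ => //.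
by rewrite subr_ge0.
Qed.

(** Coordinatewise the clipped vector [t] satisfies [t - u >= 0] and [(t - u) t = 0], so
    [|y - u|^2 >= |t - u|^2 + |y - t|^2] on the orthant, which makes [t] the only minimizer. *)
Lemma proj_nonneg_orthantE u :
  proj nonneg_orthant u = map_mx (Num.max 0) u.
Proof.
set t := map_mx _ u.
have t0 : nonneg_orthant t by move=> i; rewrite mxE le_max lexx.
have tu i : 0 <= t i 0 - u i 0 /\ (t i 0 - u i 0) * t i 0 = 0.
  by rewrite mxE; case: (leP 0 (u i 0)) => ui; split; rewrite ?subrr ?mul0r ?mulr0 //
    sub0r oppr_ge0 ltW.
have tt : dot (t - u) t = 0.
  by apply: big1 => i _; rewrite !mxE; have [_] := tu i; rewrite !mxE.
have key y : nonneg_orthant y ->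
    dot (t - u) (t - u) + dot (y - t) (y - t) <= dot (y - u) (y - u).
  move=> y0; have : 0 <= dot (t - u) y.
    by apply: dot_ge0 => // i; rewrite !mxE; have [+ _] := tu i; rewrite !mxE.
  move: tt; rewrite !dotE (dotC y t) (dotC y u) (dotC u t); lra.
have [y0 ymin] : argmin nonneg_orthant (fun x => l2norm (x - u)) (proj nonneg_orthant u).
  apply: projP; exists t; split => // y /key; rewrite ler_l2norm.
  by have := dotxx_ge0 (y - t); lra.
apply/eqP; rewrite -subr_eq0; apply/eqP/dotxx_eq0.
have := key _ y0; have := ymin _ t0; rewrite ler_l2norm.
by have := dotxx_ge0 (proj nonneg_orthant u - t); lra.
Qed.

(* The positive part of the projection z onto the monotone cone inherits the
   polarity relations because both the positive and the negative part of z,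
   max(z, 0) and min(z, 0), are monotone. *)
Lemma proj_orthant_monotone_polar u
    (t := proj nonneg_orthant (proj monotone_cone u)) :
  [/\ monotone_nonneg_cone t,
      forall y, monotone_nonneg_cone y -> dot (u - t) y <= 0
    & dot (u - t) t = 0].
Proof.
rewrite /t proj_nonneg_orthantE {t}.
have [] := proj_monotone_cone_polar u; set z := proj _ u => zm zy zz.
set t := map_mx _ z; pose m := map_mx (Num.min 0) z.
have zE : z = t + m.
  by apply/matrixP => i j; rewrite !mxE; case: leP => _; rewrite ?addr0 ?add0r.
have tm : monotone_cone t.
  by move=> i j ij; rewrite !mxE ge_max !le_max lexx zm // orbT.
have mm : monotone_cone m.
  by move=> i j ij; rewrite !mxE le_min !ge_min lexx zm // orbT.
have t0 : nonneg_orthant t by move=> i; rewrite mxE le_max lexx.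
have m0 : nonneg_orthant (- m).
  by move=> i; rewrite !mxE oppr_ge0 ge_min lexx.
have mt : dot m t = 0.
  by apply: big1 => i _; rewrite !mxE; case: leP => _; rewrite ?mul0r ?mulr0.
have dE y : dot (u - t) y = dot (u - z) y - dot (- m) y.
  by rewrite zE !dotE; lra.
split.
- by [].
- move=> y [ym y0]; rewrite dE.
  by have := zy y ym; have := dot_ge0 _ _ m0 y0; lra.
(* The zero [<u - z, z>] splits into [<u - z, t> + <u - z, m>]; both terms are nonpositive, hence
   zero. *)
- rewrite dE dotNl mt; have := zy _ tm; have := zy _ mm.
  by move: zz; rewrite {2}zE dotDr; lra.
Qed.

End Projection.

(** * The OWL norm and its proximal objective *)

Section OwlNorm.
Context {R : realType} {n : nat}.
Implicit Types (x y v w b : 'cV[R]_n) (s : 'S_n).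

Lemma owlE w x : owl w x = dot w (sort_down (vabs x)).
Proof. by rewrite /owl mxE; apply: eq_bigr => i _; rewrite mxE. Qed.

Lemma sort_down_ge0 x : nonneg_orthant x -> nonneg_orthant (sort_down x).
Proof. by move=> x0 i; have [s ->] := sort_downP x; rewrite mxE. Qed.

Lemma vabs_ge0 x : nonneg_orthant (vabs x).
Proof. by move=> i; rewrite mxE. Qed.

Lemma dot_sort_down x : dot (sort_down x) (sort_down x) = dot x x.
Proof. by have [s ->] := sort_downP x; exact: dot_row_perm. Qed.

Lemma dot_vabs x : dot (vabs x) (vabs x) = dot x x.
Proof.
by apply: eq_bigr => i _; rewrite !mxE -normrM ger0_norm // -expr2 sqr_ge0.
Qed.

(** Pass to absolute values, permute both vectors so that [|x|] is sorted, then rearrange [|y|]. *)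
Lemma dot_le_sort_down_vabs x y :
  dot x y <= dot (sort_down (vabs x)) (sort_down (vabs y)).
Proof.
have [s sE] := sort_downP (vabs x).
apply: (@le_trans _ _ (dot (vabs x) (vabs y))).
  by apply: ler_sum => i _; rewrite !mxE -normrM ler_norm.
rewrite -(dot_row_perm s) -sE -(sort_down_row_perm s (vabs y)).
exact/dot_le_sort_down/sort_down_monotone.
Qed.

(** In the order that sorts the absolute midpoint, the triangle inequality applies coordinatewise
    with weights [w >= 0]; sorting [|x|] and [|y|] separately only increases the bound, as [w] is
    monotone. *)
Lemma owl_midpoint w x y :
  monotone_nonneg_cone w ->
  owl w (2^-1 *: (x + y)) <= 2^-1 * (owl w x + owl w y).
Proof.
move=> [wm w0]; rewrite !owlE.
have half0 : 0 <= 2^-1 :> R by rewrite invr_ge0 ler0n.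
set m := 2^-1 *: _; have [s ->] := sort_downP (vabs m).
apply: (@le_trans _ _ (2^-1 *
  (dot w (row_perm s (vabs x)) + dot w (row_perm s (vabs y))))).
  rewrite -dotDr -dotZr; apply: ler_sum => i _; rewrite !mxE ler_wpM2l //.
  by rewrite normrM [`|2^-1|]ger0_norm // ler_wpM2l // ler_normD.
rewrite ler_wpM2l // lerD //.
  by rewrite -(sort_down_row_perm s (vabs x)); exact: dot_le_sort_down.
by rewrite -(sort_down_row_perm s (vabs y)); exact: dot_le_sort_down.
Qed.

(* The objective at the midpoint of two distinct minimizers would be smaller by
   at least |x - y|^2 / 8. *)
Lemma prox_owl_unique w v x y :
  monotone_nonneg_cone w -> prox (owl w) v x -> prox (owl w) v y -> x = y.
Proof.
move=> hw [_ xmin] [_ ymin]; apply/eqP; rewrite -subr_eq0; apply/eqP/dotxx_eq0.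
have := xmin (2^-1 *: (x + y)) I; have := ymin (2^-1 *: (x + y)) I.
have := owl_midpoint w x y hw; have := dotxx_ge0 (x - y).
rewrite !l2norm_sqr !dotE (dotC y x) (dotC v x) (dotC v y); lra.
Qed.

(** Sorting absolute values preserves norms and does not decrease the inner product, so distances do
    not grow. *)
Lemma owl_objective_ge w v x (a := sort_down (vabs v)) (b := sort_down (vabs x)) :
  2^-1 * dot (b - a) (b - a) + dot w b <= 2^-1 * l2norm (x - v) ^+ 2 + owl w x.
Proof.
have := dot_le_sort_down_vabs v x; rewrite -/a -/b.
have aa : dot a a = dot v v by rewrite dot_sort_down dot_vabs.
have bb : dot b b = dot x x by rewrite dot_sort_down dot_vabs.
rewrite owlE -/b l2norm_sqr !dotE aa bb (dotC b a) (dotC x v); lra.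
Qed.

End OwlNorm.

(* Otherwise zeroing t where a vanishes would give a better point of the cone. *)
Lemma polar_vanishes (R : realType) (n : nat) (a w t : 'cV[R]_n) :
  monotone_nonneg_cone a -> nonneg_orthant w -> monotone_nonneg_cone t ->
  (forall y, monotone_nonneg_cone y -> dot (a - w - t) y <= 0) ->
  dot (a - w - t) t = 0 ->
  forall i, a i 0 = 0 -> t i 0 = 0.
Proof.
move=> [am a0] w0 [tm t0] polar ortho i ai.
pose y : 'cV[R]_n := \col_j (if a j 0 == 0 then 0 else t j 0).
have /polar : monotone_nonneg_cone y.
  (* The zeros of the nonnegative monotone [a] form a final block of indices, so [y] stays
     monotone. *)
  split=> [j k jk|j]; last by rewrite mxE; case: ifP.
  rewrite !mxE; case: (eqVneq (a k 0) 0) => [_|ak]; first by case: ifP.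
  case: eqP => [aj|_]; last exact: tm.
  have := am _ _ jk; rewrite aj => ak0.
  by case/negP: ak; rewrite eq_le ak0 a0.
(* Where [a] vanishes the term is [(w + t) t]; elsewhere [y = t]. *)
have F j : 0 <= (a - w - t) j 0 * (y j 0 - t j 0).
  rewrite !mxE; case: eqP => [->|_]; last by rewrite subrr mulr0.
  by have := w0 j; have := t0 j; nra.
have -> : dot (a - w - t) y = \sum_j (a - w - t) j 0 * (y j 0 - t j 0).
  transitivity (dot (a - w - t) (y - t)); first by rewrite dotDr dotNr ortho subr0.
  by apply: eq_bigr => j _; rewrite [(y - t) j 0]mxE [(- t) j 0]mxE.
(* Polarity makes the sum nonpositive, so each of its nonnegative terms is zero; at [i] this reads
   [(w + t) t = 0]. *)
move=> S0; have /eqP : \sum_j (a - w - t) j 0 * (y j 0 - t j 0) = 0.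
  by apply/eqP; rewrite eq_le S0 sumr_ge0.
rewrite psumr_eq0 // => /allP /(_ i (mem_index_enum i)) /=.
rewrite !mxE ai eqxx => /eqP; have := w0 i; have := t0 i.
move=> ti wi E; apply/eqP; rewrite eq_le ti andbT.
nra.
Qed.

Theorem mainTheorem4 (R : realType) (n : nat) (w : 'cV[R]_n)
    (hw : monotone_nonneg_cone w) (v : 'cV[R]_n)
    (P : 'M[R]_n) (hP : sorting_perm_mx P (vabs v)) :
  prox (owl w) v =
  [set hadamard (vsign v)
         (P^T *m proj nonneg_orthant
                   (proj monotone_cone (sort_down (vabs v) - w)))].
Proof.
set t := proj nonneg_orthant _; set p := hadamard _ _; set a := sort_down _ in t p *.
have [/is_perm_mxP[s Ps] aE] := hP.
have {}aE : a = row_perm s (vabs v) by rewrite row_permE -Ps.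
have av : vabs v = row_perm s^-1 a.
  by apply/matrixP => i j; rewrite aE !mxE permKV.
have [tm polar ortho] := proj_orthant_monotone_polar (a - w).
rewrite -/t in tm polar ortho.
have am : monotone_nonneg_cone a.
  by split; [exact: sort_down_monotone|exact/sort_down_ge0/vabs_ge0].
have ta := polar_vanishes _ _ a w t am hw.2 tm polar ortho.
have pE i : p i 0 = Num.sg (v i 0) * t (s^-1%g i) 0.
  by rewrite /p Ps tr_perm_mx -row_permE !mxE.
have avi i : a (s^-1%g i) 0 = `|v i 0|.
  by have := congr1 (fun M : 'cV[R]_n => M i 0) av; rewrite !mxE.
(* Signs have modulus 1 except where [v] vanishes, and there [t] vanishes too. *)
have absp : vabs p = row_perm s^-1 t.
  apply/matrixP => i j; rewrite ord1 mxE pE [RHS]mxE normrM.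
  have [v0|v0] := eqVneq (v i 0) 0.
    by rewrite ta ?normr0 ?mulr0 // avi v0 normr0.
  by rewrite normr_sg v0 mul1r ger0_norm // tm.2.
have sortp : sort_down (vabs p) = t.
  by rewrite absp sort_down_row_perm sort_down_id //; exact: tm.1.
have pv : dot (p - v) (p - v) = dot (t - a) (t - a).
  rewrite -[RHS](dot_row_perm s^-1%g); apply: eq_bigr => i _.
  rewrite [(p - v) i 0]mxE [(- v) i 0]mxE pE ![row_perm _ _ _ _]mxE.
  rewrite ![(t - a) _ _]mxE ![(- a) _ _]mxE avi.
  have [v0|v0] := eqVneq (v i 0) 0.
    by rewrite ta ?avi v0 ?normr0 // sgr0 mul0r.
  (* Writing [v] as its sign times [|v|] lets the sign factor out, with square 1. *)
  rewrite [X in _ - X]numEsg.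
  have : Num.sg (v i 0) * Num.sg (v i 0) = 1 by rewrite -expr2 sqr_sg v0.
  set sv := Num.sg _; set tv := t _ _; set nv := `|_|.
  move=> E; transitivity ((sv * sv) * ((tv - nv) * (tv - nv))); first by ring.
  by rewrite E mul1r.
have pmin : prox (owl w) v p.
  split => // x _; apply: le_trans (owl_objective_ge w v x).
  rewrite l2norm_sqr pv owlE sortp -/a; set b := sort_down (vabs x).
  have bm : monotone_nonneg_cone b.
    by split; [exact: sort_down_monotone|exact/sort_down_ge0/vabs_ge0].
  (* By [ortho] the gap between the two sides is [|b - t|^2 / 2 - <a - w - t, b>], nonnegative by
     polarity. *)
  have := polar _ bm; have := dotxx_ge0 (b - t); move: ortho.
  rewrite !dotE (dotC b a) (dotC b t) (dotC t a); lra.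
apply/seteqP; split => [x xmin|x ->] //.
exact: prox_owl_unique hw xmin pmin.
Qed.
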